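(* Let $(G,\rho,V)$ be a prehomogeneous vector space with open orbit $\Omega$. Let $h$ be a rational function on $V$ that is holomorphic on $\Omega$. Then $h$ is an additive relative invariant if, and only if, for all $g\in G$, the quantity $h(\rho(g)(v))-h(v)$ is independent of $v\in\Omega$.
   Context: A prehomogeneous vector space $(G,\rho,V)$ is a rational representation $\rho:G\to\mathrm{GL}(V)$ of a connected complex linear algebraic group $G$ on a finite-dimensional complex vector space $V$ having a (unique) Zariski open orbit $\Omega\subseteq V$. An additive relative invariant of $(G,\rho,V)$ is a rational function $h$ on $V$ for which there exists a homomorphism of algebraic groups $\Phi:G\to\mathbb{G}_a=(\mathbb{C},+)$ with $h(\rho(g)(v))-h(v)=\Phi(g)$ for all $v\in\Omega$ and $g\in G$. *)

(* Defs.v *)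
From mathcomp Require Import all_boot all_order all_algebra.
From mathcomp Require Import fraction complex.
From mathcomp Require Import boolp classical_sets reals topology normedtype derive.
(* The notations of mpoly clash with those of classical_sets. *)
From mathcomp Require Import -(notations) mpoly.

Set Implicit Arguments.
Unset Strict Implicit.
Unset Printing Implicit Defensive.

Import Order.TTheory GRing.Theory Num.Theory.
Import numFieldNormedType.Exports.

Local Open Scope classical_set_scope.
Local Open Scope ring_scope.

(* The complex numbers are R[i] for R : realType. *)

Notation cpoly R N := (mpoly.mpoly N R[i]).

Definition zariski_closed (R : realType) (N : nat) (Z : set ('I_N -> R[i])) :=
  exists S : set (cpoly R N),
    Z = [set x | forall p, S p -> mpoly.meval x p = 0].

Definition mx_coords (R : realType) (m : nat) (g : 'M[R[i]]_m) :
    'I_(m * m) -> R[i] :=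
  fun k => mxvec g ord0 k.

Definition vec_coords (R : realType) (n : nat) (v : 'cV[R[i]]_n) :
    'I_n -> R[i] :=
  fun k => v k ord0.

Definition linear_algebraic_group (R : realType) (m : nat)
    (G : set 'M[R[i]]_m) :=
  [/\ G 1%:M,
      forall g h, G g -> G h -> G (g *m h),
      forall g, G g -> G (invmx g)
    & exists2 Z, zariski_closed Z
        & G = [set g | g \in unitmx /\ Z (mx_coords g)]].

(* Connectedness of G in the subspace topology of the Zariski topology. *)
Definition zariski_connected (R : realType) (m : nat) (G : set 'M[R[i]]_m) :=
  forall Z1 Z2 : set ('I_(m * m) -> R[i]),
    zariski_closed Z1 -> zariski_closed Z2 ->
    (forall g, G g -> Z1 (mx_coords g) \/ Z2 (mx_coords g)) ->
    (forall g, G g -> ~ (Z1 (mx_coords g) /\ Z2 (mx_coords g))) ->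
    (forall g, G g -> ~ Z1 (mx_coords g)) \/
    (forall g, G g -> ~ Z2 (mx_coords g)).

(* f restricts to an element of the coordinate ring of G, that is of the
   quotient of C[x_ij, 1/det] by the ideal of G. The values of f outside G are
   irrelevant. *)
Definition regular_function (R : realType) (m : nat) (G : set 'M[R[i]]_m)
    (f : 'M[R[i]]_m -> R[i]) :=
  exists (p : cpoly R (m * m)) (k : nat),
    forall g, G g -> f g = mpoly.meval (mx_coords g) p / (\det g) ^+ k.

Definition rational_representation (R : realType) (m n : nat)
    (G : set 'M[R[i]]_m) (rho : 'M[R[i]]_m -> 'M[R[i]]_n) :=
  [/\ forall g, G g -> rho g \in unitmx,
      forall g h, G g -> G h -> rho (g *m h) = rho g *m rho h
    & forall i j, regular_function G (fun g => rho g i j)].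

Definition zariski_open_in_V (R : realType) (n : nat) (U : set 'cV[R[i]]_n) :=
  exists2 Z, zariski_closed Z & U = [set v | ~ Z (vec_coords v)].

Definition open_orbit (R : realType) (m n : nat) (G : set 'M[R[i]]_m)
    (rho : 'M[R[i]]_m -> 'M[R[i]]_n) (Omega : set 'cV[R[i]]_n) :=
  zariski_open_in_V Omega /\
  exists v0, Omega = [set rho g *m v0 | g in G].

Definition prehomogeneous (R : realType) (m n : nat) (G : set 'M[R[i]]_m)
    (rho : 'M[R[i]]_m -> 'M[R[i]]_n) :=
  [/\ linear_algebraic_group G, zariski_connected G,
      rational_representation G rho
    & exists Omega, open_orbit G rho Omega].

Definition ratfun (R : realType) (n : nat) := {fraction (cpoly R n)}.

Definition has_value (R : realType) (n : nat) (h : ratfun R n)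
    (v : 'cV[R[i]]_n) (c : R[i]) :=
  exists p q : cpoly R n,
    [/\ mpoly.meval (vec_coords v) q != 0,
        h = FracField.tofrac p / FracField.tofrac q
      & c = mpoly.meval (vec_coords v) p / mpoly.meval (vec_coords v) q].

(* The domain of definition uses all fractions p / q representing h, not one
   chosen representative. *)
Definition defined_at (R : realType) (n : nat) (h : ratfun R n)
    (v : 'cV[R[i]]_n) :=
  exists c, has_value h v c.

(* The value of h at v, and 0 by convention where h is not defined. *)
Definition rateval (R : realType) (n : nat) (h : ratfun R n)
    (v : 'cV[R[i]]_n) : R[i] :=
  xget 0 [set c | has_value h v c].

(* differentiable is taken over the field R[i], so it is complex
   differentiability; R[i]^o is R[i] as a normed space over itself. *)
Definition holomorphic_on (R : realType) (n : nat) (h : ratfun R n)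
    (U : set 'cV[R[i]]_n) :=
  forall v, U v ->
    defined_at h v /\ differentiable (rateval h : 'cV[R[i]^o]_n -> R[i]^o) (v : 'cV[R[i]^o]_n).

Definition hom_to_Ga (R : realType) (m : nat) (G : set 'M[R[i]]_m)
    (Phi : 'M[R[i]]_m -> R[i]) :=
  (forall g1 g2, G g1 -> G g2 -> Phi (g1 *m g2) = Phi g1 + Phi g2) /\
  regular_function G Phi.

(* Definedness on Omega is implicit in writing h (rho g v) - h v = Phi g on
   Omega; it is explicit here because rateval is total. *)
Definition additive_relative_invariant (R : realType) (m n : nat)
    (G : set 'M[R[i]]_m) (rho : 'M[R[i]]_m -> 'M[R[i]]_n)
    (Omega : set 'cV[R[i]]_n) (h : ratfun R n) :=
  (forall v, Omega v -> defined_at h v) /\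
  exists2 Phi, hom_to_Ga G Phi &
    forall v g, Omega v -> G g -> rateval h (rho g *m v) - rateval h v = Phi g.

(* Main.v *)
(* Fix v0 in the open orbit and put Phi g = h(g v0) - h(v0). The independence of
   v makes Phi additive, and writing h = p / q with q(v0) <> 0 gives regular
   functions P, Q on G with Q Phi = P and Q(1) <> 0. To see that Phi itself is
   regular, note that the right translates of Q span a finite-dimensional space:
   Q(x y) = \sum_i a_i(y) Q(x g_i) with a_i regular and g_i in G. At y = x^-1
   this reads Q(1) = \sum_i a_i(x^-1) Q(x g_i), and multiplying by Phi(x) =
   Phi(x g_i) - Phi(g_i) gives
   Q(1) Phi(x) = \sum_i a_i(x^-1) (P(x g_i) - Q(x g_i) Phi(g_i)). *)
Require Import Defs.
From mathcomp Require Import all_boot all_order all_algebra.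
From mathcomp Require Import fraction complex.
From mathcomp Require Import boolp classical_sets reals topology normedtype derive.
From mathcomp Require Import -(notations) mpoly.
From mathcomp Require Import ring.

Set Implicit Arguments.
Unset Strict Implicit.
Unset Printing Implicit Defensive.

Import GRing.Theory.

Local Open Scope classical_set_scope.
Local Open Scope ring_scope.

(** * Function algebras closed under polynomial expressions *)

Definition fun_subalgebra (T : Type) (F : comNzRingType) (K : set (T -> F)) :=
  [/\ forall c, K (fun=> c),
      forall f g, K f -> K g -> K (fun x => f x + g x)
    & forall f g, K f -> K g -> K (fun x => f x * g x)].

Section FunSubalgebra.
Variables (T : Type) (F : comNzRingType) (K : set (T -> F)).
Hypothesis subK : fun_subalgebra K.

Lemma fun_subalgebra_sum (I : Type) (r : seq I) (P : pred I) (f : I -> T -> F) :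
  (forall i, K (f i)) -> K (fun x => \sum_(i <- r | P i) f i x).
Proof.
case: subK => KC KD _ Kf; elim: r => [|i r IHr].
  by under eq_fun do rewrite big_nil; exact: KC.
under eq_fun do rewrite big_cons.
by case: (P i) => //; exact: KD.
Qed.

Lemma fun_subalgebra_prod (I : Type) (r : seq I) (P : pred I) (f : I -> T -> F) :
  (forall i, K (f i)) -> K (fun x => \prod_(i <- r | P i) f i x).
Proof.
case: subK => KC _ KM Kf; elim: r => [|i r IHr].
  by under eq_fun do rewrite big_nil; exact: KC.
under eq_fun do rewrite big_cons.
by case: (P i) => //; exact: KM.
Qed.

Lemma fun_subalgebra_exp (f : T -> F) k : K f -> K (fun x => f x ^+ k).
Proof.
case: subK => KC _ KM Kf; elim: k => [|k IHk]; first exact: KC.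
by under eq_fun do rewrite exprS; exact: KM.
Qed.

Lemma fun_subalgebra_meval (N : nat) (f : 'I_N -> T -> F) (p : mpoly.mpoly N F) :
  (forall i, K (f i)) -> K (fun x => mpoly.meval (f^~ x) p).
Proof.
case: (subK) => KC _ KM Kf; under eq_fun do rewrite mpoly.mevalE.
apply: fun_subalgebra_sum => m; apply: (KM); first exact: KC.
by apply: fun_subalgebra_prod => i; apply: fun_subalgebra_exp.
Qed.

Lemma fun_subalgebra_det (n : nat) (A : T -> 'M[F]_n) :
  (forall i j, K (fun x => A x i j)) -> K (fun x => \det (A x)).
Proof.
case: (subK) => KC _ KM KA; apply: fun_subalgebra_sum => s.
by apply: KM; [exact: KC | exact: fun_subalgebra_prod].
Qed.

End FunSubalgebra.

(** Take a finite family in [G] whose rows [c (t i)] have maximal rank, which exists since ranks are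
    at most [N]. Adjoining a further [c x] cannot raise the rank, so [c x] already lies in the row
    space. *)
Lemma finite_span (F : fieldType) (T : Type) (G : set T) (N : nat)
    (c : T -> 'rV[F]_N) :
  exists (d : nat) (t : 'I_d -> T),
    (forall i, G (t i)) /\
    forall x, G x -> (c x <= \matrix_(i < d) c (t i))%MS.
Proof.
pose spans r := `[< exists (d : nat) (t : 'I_d -> T),
  (forall i, G (t i)) /\ \rank (\matrix_(i < d) c (t i)) = r >].
have ex_spans : exists r, spans r.
  exists (\rank (\matrix_(i < 0) (0 : 'rV[F]_N))); apply/asboolP.
  (* [T] may be empty, so the empty family is built by absurdity. *)
  exists 0, (fun i : 'I_0 => False_rect T (notF (valP i))).
  by split=> [[]//|]; congr mxrank; apply/matrixP=> -[].
have spans_le r : spans r -> (r <= N)%N.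
  by move=> /asboolP[d [t [_ <-]]]; exact: rank_leq_col.
case: (ex_maxnP ex_spans spans_le) => r /asboolP[d [t [Gt rk_t]]] r_max.
exists d, t; split=> // x Gx; set B := \matrix_i _ in rk_t *.
pose u (i : 'I_(1 + d)) := if split i is inr j then t j else x.
have Bu : \matrix_(i < 1 + d) c (u i) = col_mx (c x) B.
  apply/matrixP=> i j; rewrite !mxE /u; case: split => k; last by rewrite !mxE.
  by rewrite ord1.
have /r_max : spans (\rank (col_mx (c x) B)).
  apply/asboolP; exists (1 + d)%N, u; split; last by rewrite Bu.
  by move=> i; rewrite /u; case: split.
rewrite -rk_t -addsmxE => rk_le.
(* Nested row spaces of equal rank coincide. *)
have /mxrank_leqif_sup[_ eqB] : (B <= c x + B)%MS by exact: addsmxSr.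
have := eqn_leq (\rank B) (\rank (c x + B)%MS).
rewrite rk_le mxrankS ?addsmxSr // => /eqP rkE.
by move: eqB; rewrite rkE eqxx => /esym; exact/submx_trans/addsmxSl.
Qed.

(** * Regular functions on a linear algebraic group *)

Section RegularFunctions.
Variables (R : realType) (m : nat) (G : set 'M[R[i]]_m).
Hypothesis groupG : linear_algebraic_group G.

Let G1 : G 1%:M. Proof. by case: groupG. Qed.
Let GM g h : G g -> G h -> G (g *m h). Proof. by case: groupG => _ + _ _; apply. Qed.
Let GV g : G g -> G (invmx g). Proof. by case: groupG => _ _ + _; apply. Qed.
Let Gunit g : G g -> g \in unitmx.
Proof. by case: groupG => _ _ _ [Z _ ->] []. Qed.
Let Gdet g : G g -> \det g != 0.
Proof. by move/Gunit; rewrite unitmxE unitfE. Qed.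

Lemma regular_function_eq (f f' : 'M[R[i]]_m -> R[i]) :
  (forall g, G g -> f g = f' g) -> regular_function G f -> regular_function G f'.
Proof. by move=> ff' [p [k fE]]; exists p, k => g Gg; rewrite -ff' // fE. Qed.

Lemma meval_coord i j (g : 'M[R[i]]_m) :
  mpoly.meval (mx_coords g) (mpoly.mpolyX _ (mpoly.mnm1 (mxvec_index i j)))
  = g i j.
Proof. by rewrite mpoly.mevalXU /mx_coords mxvecE. Qed.

Lemma regular_function_coord i j : regular_function G (fun g => g i j).
Proof.
exists (mpoly.mpolyX _ (mpoly.mnm1 (mxvec_index i j))), 0%N => g _.
by rewrite expr0 divr1; exact/esym/meval_coord.
Qed.

Lemma det_meval : exists D : cpoly R (m * m),
  forall g : 'M[R[i]]_m, mpoly.meval (mx_coords g) D = \det g.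
Proof.
exists (\det (\matrix_(i, j)
  mpoly.mpolyX _ (mpoly.mnm1 (mxvec_index i j)))) => g.
rewrite -det_map_mx; congr determinant; apply/matrixP=> i j.
by rewrite !mxE; exact: meval_coord.
Qed.

Lemma regular_function_subalgebra : fun_subalgebra (regular_function G).
Proof.
split=> [c|f f' [p [k fE]] [p' [k' f'E]]|f f' [p [k fE]] [p' [k' f'E]]].
- by exists (mpoly.mpolyC _ c), 0%N => g _; rewrite mpoly.mevalC expr0 divr1.
- have [D DE] := det_meval.
  exists (p * D ^+ k' + p' * D ^+ k), (k + k')%N => g Gg.
  rewrite fE // f'E // mpoly.mevalD !mpoly.mevalM !rmorphXn /= DE exprD.
  by have det0 := Gdet Gg; field; rewrite !expf_neq0.
- exists (p * p'), (k + k')%N => g Gg.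
  by rewrite fE // f'E // mpoly.mevalM exprD invfM mulrACA.
Qed.

Lemma regular_function_det_inv k : regular_function G (fun g => (\det g ^+ k)^-1).
Proof. by exists 1, k => g _; rewrite mpoly.meval1 mul1r. Qed.

(** Induction on generators: the matrix entries and the inverse powers of [\det] generate the
    coordinate ring. The second premise reflects that only values on [G] count. *)
Lemma regular_function_ind (K : set ('M[R[i]]_m -> R[i])) :
  fun_subalgebra K ->
  (forall f f', (forall g, G g -> f g = f' g) -> K f -> K f') ->
  (forall i j, K (fun g => g i j)) ->
  (forall k, K (fun g => (\det g ^+ k)^-1)) ->
  regular_function G `<=` K.
Proof.
move=> subK Keq Kcoord Kdet f [p [k fE]].
apply: (@Keq (fun g => mpoly.meval (mx_coords g) p * (\det g ^+ k)^-1)).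
  by move=> g Gg; rewrite fE.
case: (subK) => _ _; apply; last exact: Kdet.
apply: (@fun_subalgebra_meval _ _ _ subK _ (fun l g => mx_coords g l)) => l.
case/mxvec_indexP: l => i j.
by rewrite /mx_coords; under eq_fun do rewrite mxvecE; exact: Kcoord.
Qed.

(** On generators: by Cramer's rule an entry of the inverse is a cofactor over the determinant, and
    inverse powers of [\det] turn into powers. *)
Lemma regular_function_invmx f :
  regular_function G f -> regular_function G (fun g => f (invmx g)).
Proof.
have subr := regular_function_subalgebra; have [rC rD rM] := subr.
move: f; apply: regular_function_ind => [|f f' ff'|i j|k].
- by split=> [c|f f'|f f']; [exact: rC | exact: rD | exact: rM].
- by apply: regular_function_eq => g /GV; exact: ff'.
- apply: (@regular_function_eq (fun g => (\det g ^+ 1)^-1 * \adj g i j)).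
    by move=> g Gg; rewrite /invmx Gunit // !mxE.
  apply: (rM); first exact: regular_function_det_inv.
  under eq_fun do rewrite mxE.
  apply: (rM); first exact: rC.
  apply: fun_subalgebra_det => // a b.
  by under eq_fun do rewrite !mxE; exact: regular_function_coord.
- apply: (@regular_function_eq (fun g => \det g ^+ k)).
    by move=> g Gg; rewrite det_inv exprVn invrK.
  apply: fun_subalgebra_exp => //; apply: fun_subalgebra_det => //.
  exact: regular_function_coord.
Qed.

(* The comultiplication of the coordinate ring of G. *)
Lemma regular_function_mulmx f : regular_function G f ->
  exists (I : finType) (w c : I -> 'M[R[i]]_m -> R[i]),
    [/\ forall i, regular_function G (w i), forall i, regular_function G (c i)
      & forall x y, G x -> G y -> f (x *m y) = \sum_i w i x * c i y].
Proof.
have [rC rD rM] := regular_function_subalgebra.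
(* Decompositions add over the disjoint union of the index types and multiply over their product.
   Entries expand by the matrix product, and [\det] is multiplicative. *)
move: f; apply: regular_function_ind => [|f f' ff'|i j|k].
- split=> [a|f f' [I [w [c [rw rc fE]]]] [J [w' [c' [rw' rc' f'E]]]]
            |f f' [I [w [c [rw rc fE]]]] [J [w' [c' [rw' rc' f'E]]]]].
  + exists unit, (fun _ _ => a), (fun _ _ => 1).
    split=> [_|_|x y _ _]; try exact: rC.
    by rewrite big_const card_unit /= addr0 mulr1.
  + exists (I + J)%type, (fun k => match k with inl i => w i | inr j => w' j end),
      (fun k => match k with inl i => c i | inr j => c' j end).
    split=> [[]|[]|x y Gx Gy] //.
    by rewrite big_sumType /= fE // f'E.
  + exists (I * J)%type, (fun k x => w k.1 x * w' k.2 x),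
      (fun k x => c k.1 x * c' k.2 x).
    split=> [k|k|x y Gx Gy]; try exact: rM.
    rewrite fE // f'E // big_distrlr pair_bigA /=.
    by apply: eq_bigr => k _; rewrite mulrACA.
- move=> [I [w [c [rw rc fE]]]]; exists I, w, c; split=> // x y Gx Gy.
  by rewrite -ff' ?fE //; exact: GM.
- exists 'I_m, (fun k g => g i k), (fun k g => g k j).
  split=> [k|k|x y _ _]; try exact: regular_function_coord.
  by rewrite mxE.
- exists unit, (fun _ g => (\det g ^+ k)^-1), (fun _ g => (\det g ^+ k)^-1).
  split=> [_|_|x y _ _]; try exact: regular_function_det_inv.
  by rewrite big_const card_unit /= addr0 det_mulmx exprMn invfM.
Qed.

Lemma regular_function_translate f y : regular_function G f -> G y ->
  regular_function G (fun x => f (x *m y)).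
Proof.
have subr := regular_function_subalgebra; have [rC _ rM] := subr.
move=> /regular_function_mulmx[I [w [c [rw _ fE]]]] Gy.
apply: (@regular_function_eq (fun x => \sum_i w i x * c i y)).
  by move=> x Gx; rewrite fE.
by apply: fun_subalgebra_sum => // i; apply: rM.
Qed.

(** In the comultiplication formula [y] enters only through the row [crow y], and finitely many such
    rows at points of [G] span all of them. *)
Lemma regular_function_translates_span f : regular_function G f ->
  exists (d : nat) (t : 'I_d -> 'M[R[i]]_m) (a : 'I_d -> 'M[R[i]]_m -> R[i]),
    [/\ forall i, G (t i), forall i, regular_function G (a i)
      & forall x y, G x -> G y -> f (x *m y) = \sum_i a i y * f (x *m t i)].
Proof.
have subr := regular_function_subalgebra; have [rC _ rM] := subr.
move=> /regular_function_mulmx[I [w [c [_ rc fE]]]].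
pose crow y : 'rV_#|I| := \row_k c (enum_val k) y.
have [d [t [Gt tspan]]] := finite_span G crow.
pose B := \matrix_(i < d) crow (t i).
(* The fixed matrix [pinvmx B] yields coordinates of [crow y] in the rows of [B]; being linear in
   [crow y], they are regular in [y]. *)
exists d, t, (fun i y => (crow y *m pinvmx B) 0 i); split=> // [i|x y Gx Gy].
  under eq_fun do rewrite mxE.
  apply: fun_subalgebra_sum => // k; apply: rM; last exact: rC.
  by under eq_fun do rewrite mxE; exact: rc.
pose wcol : 'cV_#|I| := \col_k w (enum_val k) x.
have fEcol z : G z -> f (x *m z) = (crow z *m wcol) 0 0.
  move=> Gz; rewrite fE // mxE (reindex _ (onW_bij _ (@enum_val_bij I))) /=.
  by apply: eq_bigr => k _; rewrite !mxE mulrC.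
rewrite fEcol // -{1}(mulmxKpV (tspan y Gy)) -/B -[_ *m B *m _]mulmxA mxE.
apply: eq_bigr => i _; rewrite fEcol //; congr (_ * _).
by rewrite !mxE; apply: eq_bigr => k _; rewrite !mxE.
Qed.

(** [Q] may vanish on [G], so dividing [P] by [Q] does not suffice. The finitely many translates of
    [Q] that span all others have no common zero on [G], and additivity gives an equation for [Phi]
    from each. *)
Lemma additive_regular_function (Phi P Q : 'M[R[i]]_m -> R[i]) :
  (forall x y, G x -> G y -> Phi (x *m y) = Phi x + Phi y) ->
  regular_function G P -> regular_function G Q -> Q 1%:M != 0 ->
  (forall g, G g -> Q g * Phi g = P g) ->
  regular_function G Phi.
Proof.
have subr := regular_function_subalgebra; have [rC rD rM] := subr.
move=> PhiD rP rQ Q1 QPhi.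
have [d [t [a [Gt ra Qspan]]]] := regular_function_translates_span rQ.
apply: (@regular_function_eq (fun x => (Q 1%:M)^-1 * \sum_i a i (invmx x) *
  (P (x *m t i) + - Phi (t i) * Q (x *m t i)))) => [x Gx|].
  (* Expand [Q 1%:M] as [Q (x *m invmx x)]. *)
  apply: (canLR (mulKf Q1)); rewrite -(mulmxV (Gunit Gx)) Qspan //; last exact: GV.
  rewrite mulr_suml; apply: eq_bigr => i _.
  by rewrite -QPhi ?PhiD //; [ring | exact: GM].
apply: (rM); first exact: rC.
apply: fun_subalgebra_sum => // i; apply: (rM).
  exact: regular_function_invmx.
apply: rD; first exact: regular_function_translate.
by apply: (rM); [exact: rC | exact: regular_function_translate].
Qed.

Lemma regular_function_orbit (n : nat) (rho : 'M[R[i]]_m -> 'M[R[i]]_n)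
    (v : 'cV[R[i]]_n) (p : cpoly R n) :
  rational_representation G rho ->
  regular_function G (fun g => mpoly.meval (vec_coords (rho g *m v)) p).
Proof.
have subr := regular_function_subalgebra; have [rC _ rM] := subr.
case=> _ _ rrho.
apply: (@fun_subalgebra_meval _ _ _ subr _
  (fun k g => vec_coords (rho g *m v) k)) => k.
rewrite /vec_coords; under eq_fun do rewrite mxE.
by apply: fun_subalgebra_sum => // j; apply: rM; [exact: rrho | exact: rC].
Qed.

End RegularFunctions.

(** The value at [v] may come from another fraction [p' / q']. Cross-multiplying, evaluating and
    cancelling [q'] at [v] gives a product formula that holds even where [q] vanishes at [v]. *)
Lemma rateval_fraction (R : realType) (n : nat) (p q : cpoly R n)
    (v : 'cV[R[i]]_n) :
  q != 0 -> defined_at (FracField.tofrac p / FracField.tofrac q) v ->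
  mpoly.meval (vec_coords v) q
    * rateval (FracField.tofrac p / FracField.tofrac q) v
  = mpoly.meval (vec_coords v) p.
Proof.
move=> q0 /(xgetPex 0) [p' [q' [q'v hE ratE]]].
rewrite /rateval ratE.
have q'0 : q' != 0 by apply: contraNneq q'v => ->; rewrite mpoly.meval0.
move/eqP: hE; rewrite eqr_div ?tofrac_eq0 // -!tofracM.
rewrite tofrac_eq => /eqP /(congr1 (mpoly.meval (vec_coords v))).
rewrite !mpoly.mevalM => pq'; apply: (mulIf q'v).
by rewrite pq' mulrA divfK // mulrC.
Qed.

(** * Additive relative invariants on the open orbit *)

Theorem proposition3p4 (R : realType) (m n : nat)
    (G : set 'M[R[i]]_m) (rho : 'M[R[i]]_m -> 'M[R[i]]_n)
    (Omega : set 'cV[R[i]]_n) (h : ratfun R n) :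
  prehomogeneous G rho ->
  open_orbit G rho Omega ->
  holomorphic_on h Omega ->
  (additive_relative_invariant G rho Omega h <->
   forall g, G g -> forall v w, Omega v -> Omega w ->
     rateval h (rho g *m v) - rateval h v = rateval h (rho g *m w) - rateval h w).
Proof.
move=> [groupG _ ratrho _] [_ [v0 OmegaE]] holh.
have [G1 GM GV _] := groupG; have [rhoU rhoM _] := ratrho.
(* An invertible idempotent is the identity. *)
have rho1 : rho 1%:M = 1%:M.
  have := rhoM _ _ G1 G1; rewrite mulmx1 => /(congr1 (mulmx (invmx (rho 1%:M)))).
  by rewrite mulmxA mulVmx ?rhoU // mul1mx.
have Omega_orb g : G g -> Omega (rho g *m v0) by rewrite OmegaE => Gg; exists g.
have Omega0 : Omega v0 by rewrite -[v0]mul1mx -rho1; exact: Omega_orb.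
have defh v : Omega v -> defined_at h v by move/holh => [].
(* One fraction, with denominator nonzero at [v0], serves on all of [Omega]. *)
have ratE v p q : mpoly.meval (vec_coords v0) q != 0 ->
    h = FracField.tofrac p / FracField.tofrac q -> Omega v ->
    mpoly.meval (vec_coords v) q * rateval h v = mpoly.meval (vec_coords v) p.
  move=> qv0 hE /defh; rewrite hE; apply: rateval_fraction.
  by apply: contraNneq qv0 => ->; rewrite mpoly.meval0.
rewrite /additive_relative_invariant; move: ratE; move: (rateval h) => H ratE.
split=> [[_ [Phi _ PhiE]] g Gg v w Ov Ow|indep].
  by rewrite (PhiE v) // (PhiE w).
split=> //; exists (fun g => H (rho g *m v0) - H v0); last first.
  by move=> v g Ov Gg; exact: indep.
(* Independence moves the base point of the [x]-difference from [v0] to [rho y *m v0]; the sum then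
   telescopes. *)
have PhiD x y : G x -> G y ->
    H (rho (x *m y) *m v0) - H v0 =
    (H (rho x *m v0) - H v0) + (H (rho y *m v0) - H v0).
  move=> Gx Gy; rewrite (indep x Gx _ _ Omega0 (Omega_orb y Gy)).
  by rewrite rhoM // -mulmxA addrA subrK.
split=> //.
have [_ [p [q [qv0 hE _]]]] := defh _ Omega0.
have [rC rD rM] := regular_function_subalgebra groupG.
pose orb r g := mpoly.meval (vec_coords (rho g *m v0)) r.
have rorb r : regular_function G (orb r) by exact: regular_function_orbit.
(* Subtracting [H v0] multiplies into the numerator: [P] is the pullback of [p - H(v0) q] to [G],
   and [Q] that of [q]. *)
apply: (@additive_regular_function _ _ _ groupG _
  (fun g => orb p g + - H v0 * orb q g) (orb q)) => //.
- by apply: rD => //; apply: rM => //; exact: rC.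
- by rewrite /orb rho1 mul1mx.
- move=> g Gg; rewrite mulrBr mulNr [H v0 * _]mulrC; congr (_ - _).
  exact/ratE/Omega_orb.
Qed.
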